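(* Let $V_1,V_2$ be finite nonempty sets with $n=\#V_1$, $m=\#V_2$, let $f:\mathcal P(V_1)\times\mathcal P(V_2)\to\mathbb R$ and $g:\mathcal P(V_1)\times\mathcal P(V_2)\to[0,+\infty)$, and let $f^Q,g^Q$ be their piecewise bilinear extensions. Write $\mathbb R^m_+=(0,+\infty)^m$ and $\mathbb R^n_{\ge0}=[0,+\infty)^n$. Then $$\inf_{x\in\mathbb R^n_{\ge0}\setminus\{0\}}\ \sup_{y\in\mathbb R^m_+}\frac{f^Q(x,y)}{g^Q(x,y)}=\sup_{y\in\mathbb R^m_+}\ \inf_{x\in\mathbb R^n_{\ge0}\setminus\{0\}}\frac{f^Q(x,y)}{g^Q(x,y)}\qquad(\ast)$$ holds if either of the following conditions is satisfied. (a) $g$ is positive (on pairs of nonempty sets), and $$\min_{A\in\mathcal P(V_1)\setminus\{\varnothing\}}\ \max_{B\in\mathcal P(V_2)\setminus\{\varnothing\}}\frac{f(A,B)}{g(A,B)}=\max_{B\in\mathcal P(V_2)\setminus\{\varnothing\}}\ \min_{A\in\mathcal P(V_1)\setminus\{\varnothing\}}\frac{f(A,B)}{g(A,B)}.\qquad(\ast\ast)$$ Moreover, in this case the common values in $(\ast)$ and $(\ast\ast)$ coincide, and $(A^*,B^* )$ is a saddle point of $f/g$ if and only if $(\mathbf 1_{A^*},\mathbf 1_{B^*})$ is a saddle point of $f^Q/g^Q$. (b) $g$ is modular in each component, $g(\{i\},V_2)>0$ for all $i\in V_1$ and $g(V_1,\{j\})>0$ for all $j\in V_2$; and $f$ is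 submodular in its first component and supermodular in its second component.
   Context: Convention: a discrete function of several set variables is set equal to $0$ whenever one of its arguments is $\varnothing$. Piecewise bilinear extension: for $x\in\mathbb R^n$ (indexed by $V_1$) and $y\in\mathbb R^m$ (indexed by $V_2$), let $\sigma,\tau$ be orderings of $V_1,V_2$ with $x_{\sigma(1)}\le\dots\le x_{\sigma(n)}$, $y_{\tau(1)}\le\dots\le y_{\tau(m)}$, and put $x_{\sigma(0)}=y_{\tau(0)}=0$. Then $$f^Q(x,y)=\sum_{i=0}^{n-1}\sum_{j=0}^{m-1}(x_{\sigma(i+1)}-x_{\sigma(i)})(y_{\tau(j+1)}-y_{\tau(j)})\,f\big(V_1^{\sigma(i)}(x),V_2^{\tau(j)}(y)\big),$$ where $V_1^{\sigma(0)}(x)=V_1$, $V_1^{\sigma(i)}(x)=\{l\in V_1:x_l>x_{\sigma(i)}\}$ for $i\ge1$, and $V_2^{\tau(j)}(y)$ is defined analogously. A set function $h$ is submodular if $h(A)+h(B)\ge h(A\cup B)+h(A\cap B)$ for all $A,B$, supermodular if $-h$ is submodular, modular if both. ''In its first component'' means that $A\mapsto f(A,B)$ has the property for each fixed $B$; similarly for the second component. Saddle points (minimizing in the first, maximizing in the second variable): $(A^*,B^* )$, with $A^*,B^*$ nonempty, is a saddle point of $f/g$ if $\frac{f(A^*,B)}{g(A^*,B)}\le\frac{f(A^*,B^* )}{g(A^*,B^* )}\le\frac{f(A,B^* )}{g(A,B^* )}$ for all nonempty $A,B$. The point $(\mathbf 1_{A^*},\mathbf 1_{B^*})$ is a saddle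 point of $f^Q/g^Q$ if $\frac{f^Q(\mathbf 1_{A^*},y)}{g^Q(\mathbf 1_{A^*},y)}\le\frac{f^Q(\mathbf 1_{A^*},\mathbf 1_{B^*})}{g^Q(\mathbf 1_{A^*},\mathbf 1_{B^*})}\le\frac{f^Q(x,\mathbf 1_{B^*})}{g^Q(x,\mathbf 1_{B^*})}$ for all $x\in\mathbb R^n_{\ge0}\setminus\{0\}$ and $y\in\mathbb R^m_+$. Here $\mathbf 1_A$ is the indicator vector of $A$. *)

(* Defs.v *)
From HB Require Import structures.
From mathcomp Require Import all_boot all_order all_algebra.
From mathcomp Require Import all_classical all_reals all_analysis.

Set Implicit Arguments.
Unset Strict Implicit.
Unset Printing Implicit Defensive.

Import Order.TTheory GRing.Theory Num.Theory.

Local Open Scope classical_set_scope.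
Local Open Scope ring_scope.

Section SetFunctions.
Context {R : realType} {V : finType}.
Implicit Type h : {set V} -> R.

Definition submodular h :=
  forall A B : {set V}, h (A :|: B) + h (A :&: B) <= h A + h B.

Definition supermodular h := submodular (fun A => - h A).

Definition modular h := submodular h /\ supermodular h.

End SetFunctions.

Section Vectors.
Context {R : realType} {V : finType}.
Implicit Type x : {ffun V -> R}.

Definition indic_vec (A : {set V}) : {ffun V -> R} :=
  [ffun i => (i \in A)%:R].

Definition nonneg_nonzero : set {ffun V -> R} :=
  [set x | (forall i, 0 <= x i) /\ x != 0].

Definition positive_orthant : set {ffun V -> R} := [set x | forall i, 0 < x i].

(* An ordering sigma(1), ..., sigma(n) of V along which x is nondecreasing.
   The choice made by sort is immaterial, see levelE. *)
Definition ordering x : seq V := sort (fun k l => x k <= x l) (enum V).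

(* level x i is x_{sigma(i)} for 1 <= i <= n, and level x 0 = 0. *)
Definition level x (i : nat) : R := nth 0 (0 :: [seq x k | k <- ordering x]) i.

(* For i = 0 this is all of V, whatever the signs of the x l. *)
Definition upper x (i : nat) : {set V} :=
  if i == 0%N then [set: V]%SET else [set l | level x i < x l]%SET.

Lemma levelE x (s : seq V) (i : nat) :
  perm_eq s (enum V) -> sorted (fun k l => x k <= x l) s ->
  level x i = nth 0 (0 :: [seq x k | k <- s]) i.
Proof.
move=> s_enum s_sorted; congr (nth _ (_ :: _) _).
apply: le_sorted_eq; rewrite ?sorted_map //.
  by apply: sort_sorted => k l; exact: le_total.
by rewrite perm_map // perm_sort perm_sym.
Qed.

End Vectors.

Section BilinearExtension.
Context {R : realType} {V1 V2 : finType}.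

Definition bilinear_ext (f : {set V1} -> {set V2} -> R)
    (x : {ffun V1 -> R}) (y : {ffun V2 -> R}) : R :=
  \sum_(i < #|V1|) \sum_(j < #|V2|)
    (level x i.+1 - level x i) * (level y j.+1 - level y j)
    * f (upper x i) (upper y j).

Definition vanishes_at_empty (f : {set V1} -> {set V2} -> R) :=
  (forall B, f finset.set0 B = 0) /\ (forall A, f A finset.set0 = 0).

Definition min_max (h : {set V1} -> {set V2} -> R) : \bar R :=
  \big[mine/+oo%E]_(A : {set V1} | A != finset.set0)
    \big[maxe/-oo%E]_(B : {set V2} | B != finset.set0) (h A B)%:E.

Definition max_min (h : {set V1} -> {set V2} -> R) : \bar R :=
  \big[maxe/-oo%E]_(B : {set V2} | B != finset.set0)
    \big[mine/+oo%E]_(A : {set V1} | A != finset.set0) (h A B)%:E.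

End BilinearExtension.

Section Minimax.
Context {R : realType} {S T : Type}.
Implicit Types (X : set S) (Y : set T) (h : S -> T -> R).

Definition inf_sup X Y h : \bar R :=
  ereal_inf [set ereal_sup [set (h x y)%:E | y in Y] | x in X].

Definition sup_inf X Y h : \bar R :=
  ereal_sup [set ereal_inf [set (h x y)%:E | x in X] | y in Y].

(* (x0, y0) itself is not required to lie in X `*` Y: the indicator vector of
   a proper subset is a limit point of, but not in, the open orthant. *)
Definition saddle_point X Y h (x0 : S) (y0 : T) :=
  forall x y, X x -> Y y -> h x0 y <= h x0 y0 /\ h x0 y0 <= h x y0.

End Minimax.

Definition nonempty_sets {V : finType} : set {set V} :=
  [set A | A != finset.set0].

(* Main.v *)
Require Import Defs.
From HB Require Import structures.
From mathcomp Require Import all_boot all_order all_algebra.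
From mathcomp Require Import all_classical all_reals all_analysis.
From mathcomp Require Import ring lra.

Set Implicit Arguments.
Unset Strict Implicit.
Unset Printing Implicit Defensive.

Import Order.TTheory GRing.Theory Num.Theory.

Local Open Scope classical_set_scope.
Local Open Scope ring_scope.

(** The bilinear extension is an iterated Lovasz extension: writing
    [L F x = sum_i (x_(i+1) - x_(i)) F (upper x i)], one has
    [f^Q(x, y) = L (A |-> L (f A) y) x = L (B |-> L (f^~ B) x) y].  As [L F x]
    combines, with nonnegative weights when [x >= 0], values of [F] at nonempty
    sets, an inequality between [f] and [c * g] at nonempty sets passes to
    [f^Q] and [c * g^Q].  So for the function [h_c = f - c * g] of [excess],
    comparing [f^Q / g^Q] with [c] over all vectors in one variable reduces to
    the sign of [h_c^Q] at the finitely many indicator vectors of that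
    variable.

    This gives a sufficient condition for either bound.  If one vector
    [x] has [h_c^Q(x, 1_B) <= 0] for all nonempty [B], then [inf sup <= c]
    ([inf_sup_le]).  If one vector [y >= 0] has [h_c^Q(1_A, y) > 0] for all
    nonempty [A], then [c <= sup inf] ([le_sup_inf]): the supremum is over the
    open orthant, which [y] may miss, but [L F (y + e) = L F y + e F V], and as
    there are finitely many strict inequalities they survive the passage from
    [y] to [y + e] for a small [e > 0].

    Under (a), sets [A*] and [B*] realizing the discrete min-max and max-min
    provide such vectors: [1_{A*}] for the common value [c], and [1_{B*}] for
    every value below [c].

    Under (b), it is enough that for every real [c] one of the two conditions
    holds.  Ville's theorem of the alternative ([ville_alternative]), applied to
    the finite matrix [h_c(A, B)] over nonempty [A] and all [B], gives
    nonnegative weights [q] on its columns making all the row sums positive, or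
    nonzero nonnegative weights [p] on its rows making all the column sums
    nonpositive.  Take [y = sum_B q_B 1_B] or [x = sum_A p_A 1_A]
    respectively.  Since [h_c] is submodular in its first variable and
    supermodular in the second, the subadditivity of the Lovasz extension of a
    submodular function ([lovasz_submodular_le]) turns the inequalities between
    sums into the required ones for [h_c^Q]. *)

(** * A theorem of the alternative for finite matrices *)

Section TheoremOfTheAlternative.
Context {R : realFieldType}.

Lemma small_perturbation (J : finType) (b c : J -> R) :
  (forall j, 0 < b j) -> exists2 e, 0 < e & forall j, 0 < b j + e * c j.
Proof.
move=> b_gt0.
exists (\big[Num.min/1]_j (b j / (1 + `|c j|))).
  by apply/bigmin_gtP; split=> // j _; rewrite divr_gt0 // ltr_pwDl.
move=> j; set e := \big[_/_]_j _.
have e_le : e * (1 + `|c j|) <= b j.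
  by rewrite -ler_pdivlMr ?ltr_pwDl //; exact: bigmin_le_cond.
have e_gt0 : 0 < e.
  by apply/bigmin_gtP; split=> // i _; rewrite divr_gt0 // ltr_pwDl.
have : - (e * `|c j|) <= e * c j.
  by rewrite -mulrN ler_pM2l // lerNl -normrN ler_norm.
by move=> ?; lra.
Qed.

(** Fourier-Motzkin elimination of one column [k0].  The weight of [k0] is
    bounded below by the rows positive at [k0] and above by the negative ones;
    it exists if and only if each lower bound is less than each upper bound and
    0 is less than each upper bound.  These conditions and the rows vanishing at
    [k0] form a system without [k0], whose rows are nonnegative combinations of the original ones, so that
    a dual certificate for it pulls back. *)
Lemma ville_alternative (K : eqType) (ks : seq K) (I : finType)
    (a : I -> K -> R) : uniq ks ->
  (exists2 q : K -> R, forall k, 0 <= q k &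
     forall i, 0 < \sum_(k <- ks) q k * a i k) \/
  (exists p : I -> R, [/\ forall i, 0 <= p i, exists i, 0 < p i &
     forall k, k \in ks -> \sum_i p i * a i k <= 0]).
Proof.
elim: ks I a => [|k0 ks IH] I a.
  move=> _; case: (pickP I) => [i0 _|I0].
    right; exists (fun=> 1); split=> //; by exists i0.
  by left; exists (fun=> 0) => // i; have := I0 i.
case/andP=> k0ks ks_uniq.
pose P := {i | 0 < a i k0}; pose N := {i | a i k0 <= 0}.
(* c u holds the coefficients of the row u of the reduced system; the rows
   inr (i, j) are combined so as to vanish in column k0. *)
pose c (u : N + P * N) (i : I) : R := match u with
  | inl j => (i == val j)%:R
  | inr ij => a (val ij.1) k0 * (i == val ij.2)%:R
              - a (val ij.2) k0 * (i == val ij.1)%:R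
  end.
have pickE (F : I -> R) j : \sum_i (i == j)%:R * F i = F j.
  rewrite (bigD1 j) //= eqxx mul1r big1 ?addr0 // => i /negbTE->.
  by rewrite mul0r.
have cE u k : \sum_i c u i * a i k = match u with
  | inl j => a (val j) k
  | inr ij => a (val ij.1) k0 * a (val ij.2) k - a (val ij.2) k0 * a (val ij.1) k
  end.
  case: u => [j|[i j]] /=; first by rewrite pickE.
  rewrite -(pickE (a^~ k) (val j)) -(pickE (a^~ k) (val i)) !mulr_sumr -sumrB.
  by apply: eq_bigr => l _; ring.
case: (IH _ (fun u k => \sum_i c u i * a i k) ks_uniq).
- case=> q q_ge0 q_gt0; left.
  pose S i := \sum_(k <- ks) q k * a i k.
  have S_N (j : N) : 0 < S (val j).
    have := q_gt0 (inl j); rewrite (eq_bigr _ (fun k _ => congr1 _ (cE _ k))).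
    by [].
  have S_PN (i : P) (j : N) :
      0 < a (val i) k0 * S (val j) - a (val j) k0 * S (val i).
    have := q_gt0 (inr (i, j)); rewrite (eq_bigr _ (fun k _ => congr1 _ (cE _ k))).
    rewrite /S !mulr_sumr -sumrB /=; congr (_ < _); apply: eq_bigr => k _.
    by ring.
  (* The largest lower bound on the weight of k0; the weight must exceed it
     strictly, hence the later addition of e. *)
  pose m := \big[Num.max/0]_(i : P) (- S (val i) / a (val i) k0).
  have m_ge0 : 0 <= m by exact: bigmax_ge_id.
  have m_N (j : N) : 0 < S (val j) + m * a (val j) k0.
    rewrite /m; apply: (big_ind (fun t => 0 < S (val j) + t * a (val j) k0)).
    + by rewrite mul0r addr0.
    + by move=> s t; rewrite maxEle; case: ifP.
    move=> i _; have ai := valP i; rewrite -(pmulr_rgt0 _ ai).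
    have -> : a (val i) k0 * (S (val j) + - S (val i) / a (val i) k0 * a (val j) k0) =
      a (val i) k0 * S (val j) - a (val j) k0 * S (val i).
      by field; rewrite gt_eqF.
    exact: S_PN.
  have [e e_gt0 e_N] := small_perturbation (fun j : N => a (val j) k0) m_N.
  exists (fun k => if k == k0 then m + e else q k).
    by move=> k; case: ifP => // _; rewrite addr_ge0 // ltW.
  move=> i; rewrite big_cons eqxx.
  have -> : \sum_(k <- ks) (if k == k0 then m + e else q k) * a i k = S i.
    by apply: eq_big_seq => k kks; case: eqP kks k0ks => // -> ->.
  have [ai|ai] := leP (a i k0) 0.
    by have := e_N (Sub i ai); rewrite SubK; lra.
  have : - S i / a i k0 <= m.
    by have := le_bigmax 0 (fun i : P => - S (val i) / a (val i) k0) (Sub i ai);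
      rewrite SubK.
  rewrite ler_pdivrMr // => ?.
  by have := mulr_gt0 e_gt0 ai; lra.
- case=> p [p_ge0 [u pu] p_le0]; right.
  have c_ge0 v i : 0 <= c v i.
    case: v => [j|[i1 j]] /=; first exact: ler0n.
    by rewrite subr_ge0; apply: (@le_trans _ _ 0);
      [rewrite mulr_le0_ge0 ?ler0n ?(valP j) | rewrite mulr_ge0 ?ler0n ?ltW ?(valP i1)].
  exists (fun i => \sum_v p v * c v i); split.
  + by move=> i; apply: sumr_ge0 => v _; rewrite mulr_ge0.
  + have [i cui] : exists i, 0 < c u i.
      case: u {pu} => [j|[i j]] /=.
        by exists (val j); rewrite eqxx ltr01.
      exists (val j); rewrite eqxx mulr1 (_ : val j == val i = false) ?mulr0 ?subr0 ?(valP i) //.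
      by apply/eqP => ji; have := valP j; rewrite ji leNgt (valP i).
    exists i; rewrite (bigD1 u) //= ltr_pwDl ?mulr_gt0 //.
    by apply: sumr_ge0 => v _; rewrite mulr_ge0.
  + have pcE k : \sum_i (\sum_v p v * c v i) * a i k =
        \sum_v p v * (\sum_i c v i * a i k).
      under eq_bigr do rewrite mulr_suml.
      rewrite exchange_big; apply: eq_bigr => v _; rewrite mulr_sumr.
      by apply: eq_bigr => i _; rewrite mulrA.
    move=> k; rewrite inE pcE => /orP[/eqP->|]; last exact: p_le0.
    apply: sumr_le0 => v _; rewrite mulr_ge0_le0 // cE.
    case: v => [j|[i j]] /=; first exact: (valP j).
    by rewrite mulrC subrr.
Qed.

End TheoremOfTheAlternative.

(** * Submodular set functions *)

Section Submodular.
Context {R : realType} {V : finType}.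
Implicit Types (F G : {set V} -> R).

Lemma modularE F (A B : {set V}) : modular F ->
  F (A :|: B)%SET + F (A :&: B)%SET = F A + F B.
Proof.
case=> Fsub Fsup; apply/eqP; rewrite eq_le Fsub /=.
by have := Fsup A B; lra.
Qed.

Lemma submodularB_modular F G c :
  submodular F -> modular G -> submodular (fun A => F A - c * G A).
Proof.
move=> Fsub Gmod A B.
have := congr1 ( *%R c) (modularE A B Gmod); rewrite !mulrDr.
by have := Fsub A B; lra.
Qed.

End Submodular.

(** * The Lovasz extension of a set function *)

Section LovaszExtension.
Context {R : realType} {V : finType}.
Local Arguments level : simpl never.
Implicit Types (F : {set V} -> R) (x : {ffun V -> R}).

Definition lovasz F x : R :=
  \sum_(i < #|V|) (level x i.+1 - level x i) * F (upper x i).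

Lemma ordering_perm x : perm_eq (ordering x) (enum V).
Proof. by rewrite perm_sort. Qed.

Lemma size_ordering x : size (ordering x) = #|V|.
Proof. by rewrite (perm_size (ordering_perm x)) cardE. Qed.

Lemma ordering_uniq x : uniq (ordering x).
Proof. by rewrite (perm_uniq (ordering_perm x)) enum_uniq. Qed.

Lemma mem_ordering x l : l \in ordering x.
Proof. by rewrite (perm_mem (ordering_perm x)) mem_enum. Qed.

Lemma level_index x l : level x (index l (ordering x)).+1 = x l.
Proof.
rewrite /level /= (nth_map l) ?nth_index ?mem_ordering //.
by rewrite index_mem mem_ordering.
Qed.

Lemma levelS_mono x i j : (i <= j < #|V|)%N -> level x i.+1 <= level x j.+1.
Proof.
case/andP=> ij jV; rewrite /level /=.
apply: (sorted_leq_nth le_trans) => //; rewrite ?inE ?size_map ?size_ordering //.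
  by rewrite sorted_map; apply: sort_sorted => k l; exact: le_total.
exact: leq_ltn_trans jV.
Qed.

Lemma levelS_in x i : (i < #|V|)%N -> exists l, level x i.+1 = x l.
Proof.
rewrite -(size_ordering x) => iV.
have : nth 0 [seq x k | k <- ordering x] i \in [seq x k | k <- ordering x].
  by rewrite mem_nth // size_map.
by case/mapP=> l _ il; exists l.
Qed.

Lemma level_max x l : x l <= level x #|V|.
Proof.
have lV : (index l (ordering x) < #|V|)%N.
  by rewrite -(size_ordering x) index_mem mem_ordering.
have V_gt0 : (0 < #|V|)%N := leq_ltn_trans (leq0n _) lV.
by rewrite -{1}(level_index x l) -(prednK V_gt0) levelS_mono // -ltnS prednK ?lV ?leqnn.
Qed.

Lemma level_step_ge0 x i : (forall l, 0 <= x l) -> (i < #|V|)%N ->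
  0 <= level x i.+1 - level x i.
Proof.
move=> x_ge0; rewrite subr_ge0; case: i => [|i] iV.
  by have [l ->] := levelS_in x iV; exact: x_ge0.
by rewrite levelS_mono // leqnSn.
Qed.

Lemma sum_level_steps x :
  \sum_(i < #|V|) (level x i.+1 - level x i) = level x #|V|.
Proof.
rewrite -(big_mkord xpredT (fun i => level x i.+1 - level x i)).
by rewrite telescope_sumr // /level subr0.
Qed.

(** The sets [upper x i] merge tied entries of [x]; the tails of the ordering
    form a chain in which consecutive members differ by exactly one point. *)
Definition tail x i : {set V} := [set l in drop i (ordering x)]%SET.

Lemma in_tail x i l : (l \in tail x i) = (i <= index l (ordering x))%N.
Proof.
rewrite inE; have := mem_ordering x l; have := ordering_uniq x.
rewrite -{1 2}(cat_take_drop i (ordering x)) cat_uniq mem_cat.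
case/and3P=> _ /hasPn disj _.
rewrite leqNgt.
have [lt|] := boolP (l \in take i (ordering x)).
  move=> _; rewrite -in_take ?mem_ordering // lt.
  by apply/negP => /disj; rewrite /= lt.
by move=> lt /= ->; rewrite -in_take ?mem_ordering // lt.
Qed.

Lemma tail0 x : tail x 0 = [set: V]%SET.
Proof. by apply/setP => l; rewrite in_tail inE. Qed.

Lemma tail_card x : tail x #|V| = finset.set0.
Proof.
apply/setP => l; rewrite in_tail inE leqNgt -(size_ordering x) index_mem.
by rewrite mem_ordering.
Qed.

Lemma tail_neq0 x i : (i < #|V|)%N -> tail x i != finset.set0.
Proof.
move=> iV; rewrite -card_gt0 /tail cardsE (card_uniqP _) ?drop_uniq ?ordering_uniq //.
by rewrite size_drop size_ordering subn_gt0.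
Qed.

(** [upper x i] and [tail x i] differ only inside a block of ties, where the
    coefficient of the term vanishes. *)
Lemma lovasz_tail F x :
  lovasz F x = \sum_(i < #|V|) (level x i.+1 - level x i) * F (tail x i).
Proof.
apply: eq_bigr => -[i iV] _ /=.
have [->|step] := eqVneq (level x i.+1) (level x i); first by rewrite subrr !mul0r.
congr (_ * F _); case: i iV step => [|i] iV step; first by rewrite tail0.
apply/setP => l; rewrite in_tail inE -(level_index x l).
have lV : (index l (ordering x) < #|V|)%N.
  by rewrite -(size_ordering x) index_mem mem_ordering.
have [il|li] := leqP i.+1 (index l (ordering x)).
  apply: (@lt_le_trans _ _ (level x i.+2)); last by rewrite levelS_mono ?il.
  by rewrite lt_neqAle eq_sym step levelS_mono // leqnSn.
by apply/negbTE; rewrite -leNgt levelS_mono // -ltnS li ltnW.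
Qed.

Lemma lovasz_le0 F x : (forall l, 0 <= x l) ->
  (forall S, S != finset.set0 -> F S <= 0) -> lovasz F x <= 0.
Proof.
move=> x_ge0 F_le0; rewrite lovasz_tail; apply: sumr_le0 => i _.
by rewrite mulr_ge0_le0 ?level_step_ge0 // F_le0 // tail_neq0.
Qed.

Lemma lovaszB c F F' x :
  lovasz (fun S => F S - c * F' S) x = lovasz F x - c * lovasz F' x.
Proof. by rewrite /lovasz mulr_sumr -sumrB; apply: eq_bigr => i _; ring. Qed.

Lemma lovaszN F x : lovasz (fun S => - F S) x = - lovasz F x.
Proof. by rewrite /lovasz -sumrN; apply: eq_bigr => i _; rewrite mulrN. Qed.

(** The levels of an indicator vector are 0 or 1, so at most one step is nonzero,
    and the set attached to that step is [B]. *)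
Lemma lovasz_indic F (B : {set V}) : F finset.set0 = 0 ->
  lovasz F (indic_vec B) = F B.
Proof.
move=> F0; set x : {ffun V -> R} := indic_vec B.
have [B0|/set0Pn[b bB]] := eqVneq B finset.set0.
  rewrite B0 F0 /lovasz big1 // => i _.
  have lev0 k : (k <= #|V|)%N -> level x k = 0.
    by case: k => // k kV; have [l ->] := levelS_in x kV; rewrite ffunE B0 inE.
  by rewrite !lev0 ?subrr ?mul0r // ltnW.
have lev01 k : (k <= #|V|)%N -> level x k = 0 \/ level x k = 1.
  case: k => [|k] kV; first by left.
  have [l ->] := levelS_in x kV; rewrite ffunE.
  by case: (l \in B); [right|left].
have x_ge0 l : 0 <= x l by rewrite ffunE ler0n.
have -> : lovasz F x = \sum_(i < #|V|) (level x i.+1 - level x i) * F B.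
  apply: eq_bigr => -[i iV] _ /=.
  have := level_step_ge0 x_ge0 iV.
  case: (lev01 i.+1 iV) => lS; case: (lev01 i (ltnW iV)) => l0; rewrite lS l0;
    rewrite ?subrr ?mul0r // ?sub0r ?oppr_ge0 ?ler10 // => _.
  congr (_ * F _); apply/setP => l; rewrite /upper.
  case: i iV lS l0 => [|i] iV lS l0 /=; last first.
    by rewrite inE l0 ffunE; case: (l \in B); rewrite ?ltr01 ?ltxx.
  have : level x 1 <= x l.
    rewrite -(level_index x l) levelS_mono //=.
    by rewrite -(size_ordering x) index_mem mem_ordering.
  by rewrite lS inE ffunE; case: (l \in B) => //; rewrite ler10.
rewrite -mulr_suml sum_level_steps.
suff -> : level x #|V| = 1 by rewrite mul1r.
case: (lev01 _ (leqnn _)) => // lev0.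
by have := level_max x b; rewrite lev0 ffunE bB ler10.
Qed.

(** Adding a constant keeps the ordering and the upper sets, and changes only
    the first step, whose set is the whole of [V]. *)
Lemma lovasz_shift F x c : (0 < #|V|)%N ->
  lovasz F [ffun l => x l + c] = lovasz F x + c * F [set: V]%SET.
Proof.
move=> V_gt0; set x' := [ffun l => x l + c].
have ordE : ordering x' = ordering x.
  by congr (sort _ _); apply/funext => k; apply/funext => l; rewrite !ffunE lerD2r.
have levE i : (i < #|V|)%N -> level x' i.+1 = level x i.+1 + c.
  rewrite -(size_ordering x) /level /= ordE; case: (ordering x) => // l0 s iV.
  by rewrite !(nth_map l0) // ffunE.
rewrite /lovasz; case: #|V| V_gt0 levE => // n _ levE.
have lev0 z : level z 0 = 0 :> R by [].
rewrite !big_ord_recl /= levE // !lev0 !subr0.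
rewrite mulrDl -!addrA; congr (_ + _); rewrite addrC; congr (_ + _).
apply: eq_bigr => i _; rewrite /bump /= add1n.
have iV : (i < n.+1)%N by rewrite ltnS ltnW.
rewrite !levE ?ltnS //; congr (_ * F _); first by ring.
by apply/setP => l; rewrite !inE levE // ffunE ltrD2r.
Qed.

(** In [nonneg_nonzero] the comparison with 0 is between plain functions, not
    finite ones. *)
Lemma nonneg_nonzeroP x :
  nonneg_nonzero x <-> (forall l, 0 <= x l) /\ exists l, 0 < x l.
Proof.
split=> [[x_ge0 x_neq0]|[x_ge0 [l xl]]]; split=> //.
  apply: contrapT => /forallNP x_le0; move/eqP: x_neq0; apply.
  apply/funext => l; apply/eqP; rewrite eq_le x_ge0 andbT leNgt.
  exact/negP/x_le0.
by apply/eqP => /(congr1 (fun h => h l)) xl0; rewrite xl0 ltxx in xl.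
Qed.

Lemma positive_orthant_nonneg_nonzero x :
  (0 < #|V|)%N -> positive_orthant x -> nonneg_nonzero x.
Proof.
move=> /card_gt0P[l _] x_gt0; apply/nonneg_nonzeroP.
by split=> [k|]; [exact/ltW/x_gt0|exists l; exact: x_gt0].
Qed.

Lemma indic_vec_nonneg_nonzero (A : {set V}) :
  A != finset.set0 -> nonneg_nonzero (indic_vec A : {ffun V -> R}).
Proof.
case/set0Pn=> l lA; apply/nonneg_nonzeroP; split=> [k|].
  by rewrite ffunE ler0n.
by exists l; rewrite ffunE lA ltr01.
Qed.

Lemma lovasz_gt0 F x : (forall S, S != finset.set0 -> 0 < F S) ->
  nonneg_nonzero x -> 0 < lovasz F x.
Proof.
move=> F_gt0 /nonneg_nonzeroP[x_ge0 [l xl]]; rewrite lovasz_tail.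
have ge0 (i : 'I_#|V|) : true -> 0 <= (level x i.+1 - level x i) * F (tail x i).
  by rewrite mulr_ge0 ?level_step_ge0 // ltW // F_gt0 // tail_neq0.
rewrite lt_neqAle sumr_ge0 ?andbT //.
have : 0 < level x #|V| := lt_le_trans xl (level_max x l).
rewrite -sum_level_steps; apply: contra_ltN => /eqP/esym sum0.
rewrite big1 // => i _; have /(_ i isT)/eqP := psumr_eq0P ge0 sum0.
by rewrite mulf_eq0 (gt_eqF (F_gt0 _ (tail_neq0 _ _))) // orbF => /eqP.
Qed.

Lemma lovasz_gt0_orthant F x : (0 < #|V|)%N -> (forall S, 0 <= F S) ->
  0 < F [set: V]%SET -> positive_orthant x -> 0 < lovasz F x.
Proof.
move=> V_gt0 F_ge0 FV x_gt0.
have x_ge0 l : 0 <= x l by exact/ltW/x_gt0.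
rewrite /lovasz (bigD1 (Ordinal V_gt0)) //= ltr_pwDl //; last first.
  by apply: sumr_ge0 => i _; rewrite mulr_ge0 ?level_step_ge0.
have [l ->] := levelS_in x V_gt0.
by rewrite mulr_gt0 // subr_gt0; exact: x_gt0.
Qed.

(** The marginals of [F] along the chain of tails: the vector that the greedy
    algorithm for the base polytope of [F] returns in the direction [x]. *)
Definition greedy F x (l : V) : R :=
  F (tail x (index l (ordering x))) - F (tail x (index l (ordering x)).+1).

Lemma sum_rank x (G : nat -> R) :
  \sum_l G (index l (ordering x)) = \sum_(i < #|V|) G i.
Proof.
rewrite -big_enum -(perm_big _ (ordering_perm x)) -(big_mkord xpredT).
rewrite -(size_ordering x); case E : (ordering x) => [|l0 s].
  by rewrite big_nil big_geq.
rewrite -E (big_nth l0) !big_nat; apply: eq_bigr => i /andP[_ ilt].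
by rewrite index_uniq // ordering_uniq.
Qed.

Lemma tail_index x l : let i := index l (ordering x) in
  tail x i = (l |: tail x i.+1)%SET.
Proof.
apply/setP => k; rewrite in_setU1 !in_tail leq_eqVlt; congr (_ || _).
apply/eqP/eqP => [|->//]; move/esym.
by move/(congr1 (nth l (ordering x))); rewrite !nth_index ?mem_ordering.
Qed.

(** Abel summation: on the vectors sharing the ordering of [x] the extension is
    the linear form with coefficients [greedy F x]. *)
Lemma lovasz_greedy F x : F finset.set0 = 0 ->
  lovasz F x = \sum_l x l * greedy F x l.
Proof.
move=> F0; rewrite lovasz_tail.
under [RHS]eq_bigr do rewrite -{1}(level_index x).
rewrite (sum_rank x (fun i => level x i.+1 * (F (tail x i) - F (tail x i.+1)))).
apply/eqP; rewrite -subr_eq0 -sumrB; apply/eqP.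
pose T i := level x i * F (tail x i).
transitivity (\sum_(i < #|V|) (T i.+1 - T i)).
  by apply: eq_bigr => i _; rewrite /T; ring.
rewrite -(big_mkord xpredT (fun i => T i.+1 - T i)) telescope_sumr //.
by rewrite /T tail_card F0 mulr0 mul0r subrr.
Qed.

(** The greedy vector lies in the base polytope.  Along the chain of tails,
    submodularity bounds the marginal of a point of [A] by its marginal in the chain
    intersected with [A], and the latter marginals telescope to [F A]. *)
Lemma greedy_le F x (A : {set V}) : submodular F -> F finset.set0 = 0 ->
  \sum_(l in A) greedy F x l <= F A.
Proof.
move=> F_sub F0; pose G i := F (A :&: tail x i.+1)%SET - F (A :&: tail x i)%SET.
have -> : F A = \sum_l - G (index l (ordering x)).
  rewrite sumrN sum_rank -(big_mkord xpredT) telescope_sumr //.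
  by rewrite tail_card tail0 finset.setI0 finset.setIT F0 sub0r opprK.
rewrite big_mkcond; apply: ler_sum => l _; rewrite /G /greedy opprB tail_index.
set D := tail x _.+1; case: ifPn => lA; last first.
  rewrite finset.setIUr (_ : A :&: [set l] = finset.set0)%SET ?finset.set0U ?subrr //.
  by apply/setP => k; rewrite !inE; case: eqP => [->|]; rewrite ?(negbTE lA) ?andbF.
have lD : l \notin D by rewrite in_tail ltnn.
have := F_sub (A :&: (l |: D))%SET D.
have -> : ((A :&: (l |: D)) :|: D = l |: D)%SET.
  by apply/setP => k; rewrite !inE; case: eqP => [->|]; rewrite ?lA //=; do 2?case: (_ \in _).
have -> : ((A :&: (l |: D)) :&: D = A :&: D)%SET.
  apply/setP => k; rewrite !finset.in_setI finset.in_setU1; case: eqP => [->|] //=.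
    by rewrite (negbTE lD) !andbF.
  by rewrite -andbA andbb.
lra.
Qed.

(** The linear form of [greedy F x] agrees with the extension at [x] and is at
    most [F (S i)] at the indicator vector of [S i]. *)
Lemma lovasz_submodular_le F (I : finType) (p : I -> R) (S : I -> {set V}) :
  submodular F -> F finset.set0 = 0 -> (forall i, 0 <= p i) ->
  lovasz F [ffun l => \sum_i p i * indic_vec (S i) l] <= \sum_i p i * F (S i).
Proof.
move=> F_sub F0 p_ge0; set x := finfun _; rewrite lovasz_greedy //.
have -> : \sum_l x l * greedy F x l =
    \sum_i p i * \sum_(l in S i) greedy F x l.
  under eq_bigr do rewrite ffunE mulr_suml.
  rewrite exchange_big; apply: eq_bigr => i _; rewrite mulr_sumr big_mkcond.
  rewrite [RHS]big_mkcond /=; apply: eq_bigr => l _; rewrite ffunE.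
  by case: (l \in S i); rewrite ?mulr1 ?mulr0 ?mul0r.
by apply: ler_sum => i _; rewrite ler_wpM2l // greedy_le.
Qed.

End LovaszExtension.

(** * Comparison of extended reals *)

Section ErealComparison.
Context {R : realType}.

(** A strict inequality [a < b] would leave room for a real number strictly in
    between.  This reduces a minimax equality to a dichotomy at each real
    level. *)
Lemma le_ereal_of_alternative (a b : \bar R) :
  (forall c : R, (b <= c%:E)%E \/ (c%:E <= a)%E) -> (b <= a)%E.
Proof.
move=> alt; rewrite leNgt; apply/negP => ab.
suff [c ac cb] : exists2 c : R, (a < c%:E)%E & (c%:E < b)%E.
  by case: (alt c); rewrite leNgt ?ac ?cb.
case: a b ab {alt} => [r||] [s||] //=.
- rewrite lte_fin => rs; exists ((r + s) / 2); rewrite lte_fin; lra.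
- by move=> _; exists (r + 1); rewrite ?ltry // lte_fin ltrDl.
- by move=> _; exists (s - 1); rewrite ?ltNyr // lte_fin gtrBl.
- by move=> _; exists 0; rewrite ?ltry ?ltNyr.
Qed.

Lemma sup_inf_le_inf_sup (S T : Type) (X : set S) (Y : set T) (h : S -> T -> R) :
  (sup_inf X Y h <= inf_sup X Y h)%E.
Proof.
apply: ge_ereal_sup => _ [y Yy <-]; apply: le_ereal_inf_tmp => _ [x Xx <-].
apply: (@le_trans _ _ (h x y)%:E).
  by apply: ereal_inf_lbound; exists x.
by apply: ereal_sup_ubound; exists y.
Qed.

End ErealComparison.

(** * Attainment of the discrete min-max and max-min *)

Section FiniteMinMax.
Context {R : realType} {V1 V2 : finType}.
Implicit Types h : {set V1} -> {set V2} -> R.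

Lemma bigmaxe_attained (V : finType) (F : {set V} -> R) : (0 < #|V|)%N ->
  exists2 B, B != finset.set0 &
    \big[maxe/-oo%E]_(B : {set V} | B != finset.set0) (F B)%:E = (F B)%:E.
Proof.
move=> V_gt0.
have VT : [set: V]%SET != finset.set0 by rewrite -card_gt0 cardsT.
have [B BN ->] := eq_bigmax (I := {set V}) (x := -oo%E) _
  (fun B => B != finset.set0) (fun B => (F B)%:E) VT (fun _ _ => leNye _).
by exists B.
Qed.

Lemma bigmine_attained (V : finType) (F : {set V} -> R) : (0 < #|V|)%N ->
  exists2 A, A != finset.set0 &
    \big[mine/+oo%E]_(A : {set V} | A != finset.set0) (F A)%:E = (F A)%:E.
Proof.
move=> V_gt0.
have VT : [set: V]%SET != finset.set0 by rewrite -card_gt0 cardsT.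
have [B BN ->] := eq_bigmin (I := {set V}) (x := +oo%E) _
  (fun B => B != finset.set0) (fun B => (F B)%:E) VT (fun _ _ => leey _).
by exists B.
Qed.

Hypotheses (V1_gt0 : (0 < #|V1|)%N) (V2_gt0 : (0 < #|V2|)%N).

Lemma min_max_attained h : exists c : R, min_max h = c%:E /\
  exists2 A, A != finset.set0 & forall B, B != finset.set0 -> h A B <= c.
Proof.
pose M A := sval (cid2 (bigmaxe_attained (h A) V2_gt0)).
have ME A : \big[maxe/-oo%E]_(B : {set V2} | B != finset.set0) (h A B)%:E =
  (h A (M A))%:E by rewrite /M; case: cid2.
have [A AN minE] := bigmine_attained (fun A => h A (M A)) V1_gt0.
exists (h A (M A)); split.
  by rewrite -minE; apply: eq_bigr => A' _.
exists A => // B BN; rewrite -lee_fin -ME.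
exact: (le_bigmax_cond _ (fun B => (h A B)%:E)).
Qed.

Lemma max_min_attained h : exists c : R, max_min h = c%:E /\
  exists2 B, B != finset.set0 & forall A, A != finset.set0 -> c <= h A B.
Proof.
pose M B := sval (cid2 (bigmine_attained (h^~ B) V1_gt0)).
have ME B : \big[mine/+oo%E]_(A : {set V1} | A != finset.set0) (h A B)%:E =
  (h (M B) B)%:E by rewrite /M; case: cid2.
have [B BN maxE] := bigmaxe_attained (fun B => h (M B) B) V2_gt0.
exists (h (M B) B); split.
  by rewrite -maxE; apply: eq_bigr => B' _.
exists B => // A AN; rewrite -lee_fin -ME.
exact: (bigmin_le_cond _ (fun A => (h A B)%:E)).
Qed.

End FiniteMinMax.

(** * The two bounds at a real level *)

Section Ratio.
Context {R : realType} {V1 V2 : finType}.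
Implicit Types (f g : {set V1} -> {set V2} -> R).

Lemma bilinear_extE f x y :
  bilinear_ext f x y = lovasz (fun A => lovasz (f A) y) x.
Proof.
apply: eq_bigr => i _; rewrite /lovasz mulr_sumr.
by apply: eq_bigr => j _; rewrite mulrA.
Qed.

Lemma bilinear_extC f x y :
  bilinear_ext f x y = lovasz (fun B => lovasz (f^~ B) x) y.
Proof.
rewrite /bilinear_ext exchange_big; apply: eq_bigr => j _.
by rewrite /lovasz mulr_sumr; apply: eq_bigr => i _; rewrite mulrCA mulrA.
Qed.

Lemma bilinear_ext_indicl f A y : vanishes_at_empty f ->
  bilinear_ext f (indic_vec A) y = lovasz (f A) y.
Proof.
case=> f0 _; rewrite bilinear_extE lovasz_indic //.
by rewrite /lovasz big1 // => j _; rewrite f0 mulr0.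
Qed.

Lemma bilinear_ext_indicr f x B : vanishes_at_empty f ->
  bilinear_ext f x (indic_vec B) = lovasz (f^~ B) x.
Proof.
case=> _ f0; rewrite bilinear_extC lovasz_indic //.
by rewrite /lovasz big1 // => j _; rewrite f0 mulr0.
Qed.

(** The sign of the excess compares [f / g] with [c] without division, and its
    extension is linear in [f] and [g]. *)
Definition excess f g c A B : R := f A B - c * g A B.

Lemma bilinear_ext_excess f g c x y :
  bilinear_ext (excess f g c) x y = bilinear_ext f x y - c * bilinear_ext g x y.
Proof.
rewrite !bilinear_extE -lovaszB; congr (lovasz _ x); apply/funext => A.
by rewrite /excess lovaszB.
Qed.

Variables f g : {set V1} -> {set V2} -> R.
Hypothesis V2_gt0 : (0 < #|V2|)%N.
Hypothesis g_ge0 : forall A B, 0 <= g A B.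
Hypothesis gT_gt0 : forall A, A != finset.set0 -> 0 < g A [set: V2]%SET.

Local Notation X := (@nonneg_nonzero R V1).
Local Notation Y := (@positive_orthant R V2).
Let rQ x y := bilinear_ext f x y / bilinear_ext g x y.

(** Positivity of [g] on pairs of nonempty sets may fail under (b); because [y] is
    positive, its first step is positive and carries the full set [V2]. *)
Lemma bilinear_ext_gt0 x y : X x -> Y y -> 0 < bilinear_ext g x y.
Proof.
move=> Xx Yy; rewrite bilinear_extE; apply: lovasz_gt0 => // A AN.
exact: lovasz_gt0_orthant (gT_gt0 AN) Yy.
Qed.

(** A small positive constant added to [y] moves it into the open orthant, and
    the finitely many strict inequalities tolerate this. *)
Lemma le_sup_inf c (y : {ffun V2 -> R}) : (forall l, 0 <= y l) ->
  (forall A, A != finset.set0 -> 0 < lovasz (excess f g c A) y) ->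
  (c%:E <= sup_inf X Y rQ)%E.
Proof.
move=> y_ge0 y_gt0; pose J := {A : {set V1} | A != finset.set0}.
have [e e_gt0 He] := small_perturbation
  (fun A : J => excess f g c (val A) [set: V2]%SET) (fun A => y_gt0 _ (valP A)).
pose y' := [ffun l => y l + e].
have Yy' : Y y' by move=> l; rewrite ffunE ltr_wpDl.
apply: (@le_trans _ _ (ereal_inf [set (rQ x y')%:E | x in X])).
  apply: le_ereal_inf_tmp => _ [x Xx <-]; rewrite lee_fin /rQ.
  rewrite ler_pdivlMr ?bilinear_ext_gt0 // -subr_ge0 -bilinear_ext_excess ltW //.
  rewrite bilinear_extE; apply: lovasz_gt0 => // A AN.
  by rewrite lovasz_shift //; have := He (Sub A AN); rewrite SubK.
by apply: ereal_sup_ubound; exists y'.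
Qed.

Lemma inf_sup_le c (x : {ffun V1 -> R}) : X x ->
  (forall B, B != finset.set0 -> lovasz (excess f g c ^~ B) x <= 0) ->
  (inf_sup X Y rQ <= c%:E)%E.
Proof.
move=> Xx x_le0.
apply: (@le_trans _ _ (ereal_sup [set (rQ x y)%:E | y in Y])).
  by apply: ereal_inf_lbound; exists x.
apply: ge_ereal_sup => _ [y Yy <-]; rewrite lee_fin /rQ.
rewrite ler_pdivrMr ?bilinear_ext_gt0 // -subr_le0 -bilinear_ext_excess.
by rewrite bilinear_extC; apply: lovasz_le0 => // l; exact/ltW/Yy.
Qed.

End Ratio.

(** * The minimax equality and saddle points *)

Section SaddleValue.
Context {R : realType} {V1 V2 : finType}.
Variables f g : {set V1} -> {set V2} -> R.
Hypotheses (V1_gt0 : (0 < #|V1|)%N) (V2_gt0 : (0 < #|V2|)%N).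
Hypotheses (f0 : vanishes_at_empty f) (g0 : vanishes_at_empty g).
Hypothesis g_ge0 : forall A B, 0 <= g A B.

Local Notation X := (@nonneg_nonzero R V1).
Local Notation Y := (@positive_orthant R V2).
Let r A B := f A B / g A B.
Let rQ x y := bilinear_ext f x y / bilinear_ext g x y.

Lemma excess_vanishes c : vanishes_at_empty (excess f g c).
Proof.
by case: f0 g0 => f1 f2 [g1 g2]; split=> C;
  rewrite /excess ?f1 ?f2 ?g1 ?g2 mulr0 subrr.
Qed.

Section Positive.
Hypothesis g_gt0 : forall A B, A != finset.set0 -> B != finset.set0 -> 0 < g A B.

Let setT_neq0 (V : finType) : (0 < #|V|)%N -> [set: V]%SET != finset.set0.
Proof. by rewrite -card_gt0 cardsT. Qed.

Lemma minimax_values : min_max r = max_min r ->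
  inf_sup X Y rQ = sup_inf X Y rQ /\ inf_sup X Y rQ = min_max r.
Proof.
have [c [-> [A AN cA]]] := min_max_attained V1_gt0 V2_gt0 r.
have [c' [-> [B BN cB]]] := max_min_attained V1_gt0 V2_gt0 r.
case=> cc'; rewrite -cc' in cB.
have gT_gt0 A' : A' != finset.set0 -> 0 < g A' [set: V2]%SET.
  by move=> ?; rewrite g_gt0 ?setT_neq0.
have upper : (inf_sup X Y rQ <= c%:E)%E.
  apply: (inf_sup_le V2_gt0 g_ge0 gT_gt0 (indic_vec_nonneg_nonzero AN)) => B' BN'.
  rewrite lovasz_indic; last by case: (excess_vanishes c).
  by rewrite subr_le0 -ler_pdivrMr ?g_gt0 ?cA.
have lower : (c%:E <= sup_inf X Y rQ)%E.
  apply: le_ereal_of_alternative => d; have [cd|dc] := leP c d.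
    by left; rewrite lee_fin.
  right; apply: (le_sup_inf V2_gt0 g_ge0 gT_gt0 (y := indic_vec B)).
    by move=> l; rewrite ffunE ler0n.
  move=> A' AN'; rewrite lovasz_indic; last by case: (excess_vanishes d).
  by rewrite subr_gt0 -ltr_pdivlMr ?g_gt0 // (lt_le_trans dc) // cB.
have weak := sup_inf_le_inf_sup X Y rQ.
by split; apply/eqP; rewrite eq_le; apply/andP; split=> //;
  [exact: le_trans lower|exact: le_trans weak].
Qed.

(** From right to left, the indicator vectors on the [V1] side are admissible, but
    [indic_vec B'] is only a limit of points [indic_vec B' + e] of the open
    orthant: a strict violation of the inequality at [B'] would persist for some
    [e > 0]. *)
Lemma saddle_point_indic A B : A != finset.set0 -> B != finset.set0 ->
  saddle_point nonempty_sets nonempty_sets r A B <->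
  saddle_point X Y rQ (indic_vec A) (indic_vec B).
Proof.
move=> AN BN.
have rQl y : rQ (indic_vec A) y = lovasz (f A) y / lovasz (g A) y.
  by rewrite /rQ !bilinear_ext_indicl.
have rQr x : rQ x (indic_vec B) = lovasz (f^~ B) x / lovasz (g^~ B) x.
  by rewrite /rQ !bilinear_ext_indicr.
have [f0l f0r] := f0; have [g0l g0r] := g0.
have rAB : rQ (indic_vec A) (indic_vec B) = r A B.
  by rewrite rQl !lovasz_indic.
split=> [sad x y Xx Yy|sad A' B' AN' BN']; rewrite ?rAB.
  have XBy := positive_orthant_nonneg_nonzero V2_gt0 Yy.
  split.
    rewrite rQl ler_pdivrMr; last by apply: lovasz_gt0 => // B' BN'; exact: g_gt0.
    rewrite -subr_le0 -lovaszB; apply: lovasz_le0; first by case/nonneg_nonzeroP: XBy.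
    move=> B' BN'; rewrite subr_le0 -ler_pdivrMr ?g_gt0 //.
    by have [] := sad A B' AN BN'.
  rewrite rQr ler_pdivlMr; last by apply: lovasz_gt0 => // A' AN'; exact: g_gt0.
  rewrite -subr_ge0 -lovaszB -oppr_le0 -lovaszN.
  apply: lovasz_le0; first by case/nonneg_nonzeroP: Xx.
  move=> A' AN'; rewrite oppr_le0 subr_ge0 -ler_pdivlMr ?g_gt0 //.
  by have [] := sad A' B AN' BN.
have Yshift (B0 : {set V2}) e : 0 < e -> Y [ffun l => indic_vec B0 l + e].
  by move=> e_gt0 l; rewrite !ffunE ltr_wpDl.
split; last first.
  have [_] := sad _ _ (indic_vec_nonneg_nonzero AN') (Yshift B' _ ltr01).
  by rewrite rAB rQr !lovasz_indic.
rewrite -/(r A B) ler_pdivrMr ?g_gt0 // leNgt -subr_gt0; apply/negP => pos.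
have [e e_gt0 /(_ tt)] := small_perturbation
  (fun _ : unit => excess f g (r A B) A [set: V2]%SET) (fun=> pos).
have [+ _] := sad _ _ (indic_vec_nonneg_nonzero AN) (Yshift B' e e_gt0).
rewrite rAB rQl ler_pdivrMr; last first.
  apply: lovasz_gt0; first by move=> S; exact: g_gt0.
  exact/positive_orthant_nonneg_nonzero/Yshift.
rewrite !lovasz_shift // !lovasz_indic // /excess; nra.
Qed.

End Positive.

Lemma convex_concave_minimax :
  (forall B, modular (g^~ B)) -> (forall A, modular (g A)) ->
  (forall i, 0 < g [set i]%SET [set: V2]%SET) ->
  (forall B, submodular (f^~ B)) -> (forall A, supermodular (f A)) ->
  inf_sup X Y rQ = sup_inf X Y rQ.
Proof.
move=> gmod1 gmod2 gi_gt0 fsub fsup.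
have gT_gt0 A : A != finset.set0 -> 0 < g A [set: V2]%SET.
  case/set0Pn=> i iA.
  have := modularE [set i]%SET (A :\ i)%SET (gmod1 [set: V2]%SET).
  rewrite finset.setD1K // (_ : [set i] :&: (A :\ i) = finset.set0)%SET; last first.
    by apply/setP => j; rewrite !inE; case: eqP.
  rewrite g0.1 addr0 => ->; exact: ltr_pwDl.
apply/eqP; rewrite eq_le sup_inf_le_inf_sup andbT.
apply: le_ereal_of_alternative => c.
pose h := excess f g c; have [h0l h0r] := excess_vanishes c.
pose I := {A : {set V1} | A != finset.set0}.
have [[q q_ge0 q_gt0]|[p [p_ge0 [i0 pi0] p_le0]]] :=
  ville_alternative (fun (i : I) B => h (val i) B) (enum_uniq {set V2}).
- right.
  apply: (le_sup_inf V2_gt0 g_ge0 gT_gt0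
    (y := [ffun l => \sum_B q B * indic_vec B l])).
    by move=> l; rewrite ffunE sumr_ge0 // => B _; rewrite mulr_ge0 // ffunE ler0n.
  move=> A AN; have := q_gt0 (Sub A AN); rewrite big_enum SubK /= => /lt_le_trans; apply.
  rewrite -lerN2 -lovaszN -sumrN.
  under eq_bigr do rewrite -mulrN.
  apply: (lovasz_submodular_le (F := fun B => - h A B)) => //; last by rewrite /h h0r oppr0.
  have -> : (fun B => - h A B) = (fun B => - f A B - - c * g A B).
    by apply/funext => B; rewrite /h /excess; ring.
  apply: (@submodularB_modular _ V2 (fun B => - f A B) (g A) (- c)); [exact: fsup|exact: gmod2].
- left.
  apply: (inf_sup_le V2_gt0 g_ge0 gT_gt0
    (x := [ffun l => \sum_i p i * indic_vec (val i) l])).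
    apply/nonneg_nonzeroP; split=> [l|].
      by rewrite ffunE sumr_ge0 // => i _; rewrite mulr_ge0 // ffunE ler0n.
    have /set0Pn[l li0] := valP i0; exists l; rewrite ffunE (bigD1 i0) //=.
    rewrite ltr_pwDl ?ffunE ?li0 ?mulr1 //.
    by apply: sumr_ge0 => i _; rewrite mulr_ge0 // ffunE ler0n.
  move=> B BN; apply: le_trans (p_le0 B _); last by rewrite mem_enum.
  apply: (lovasz_submodular_le (F := h^~ B)) => //.
  exact: submodularB_modular.
Qed.

End SaddleValue.

Theorem theorem1p1 (R : realType) (V1 V2 : finType)
    (V1_gt0 : (0 < #|V1|)%N) (V2_gt0 : (0 < #|V2|)%N)
    (f g : {set V1} -> {set V2} -> R)
    (f0 : vanishes_at_empty f) (g0 : vanishes_at_empty g)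
    (g_ge0 : forall A B, 0 <= g A B) :
  let r := fun A B => f A B / g A B in
  let rQ := fun x y => bilinear_ext f x y / bilinear_ext g x y in
  ((forall A B, A != finset.set0 -> B != finset.set0 -> 0 < g A B) ->
    min_max r = max_min r ->
    [/\ inf_sup nonneg_nonzero positive_orthant rQ = sup_inf nonneg_nonzero positive_orthant rQ,
        inf_sup nonneg_nonzero positive_orthant rQ = min_max r &
        forall A B, A != finset.set0 -> B != finset.set0 ->
          saddle_point nonempty_sets nonempty_sets r A B <->
          saddle_point nonneg_nonzero positive_orthant rQ (indic_vec A) (indic_vec B)])
  /\
  ((forall B, modular (fun A => g A B)) -> (forall A, modular (g A)) ->
    (forall i, 0 < g [set i]%SET [set: V2]%SET) ->
    (forall j, 0 < g [set: V1]%SET [set j]%SET) ->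
    (forall B, submodular (fun A => f A B)) ->
    (forall A, supermodular (f A)) ->
    inf_sup nonneg_nonzero positive_orthant rQ = sup_inf nonneg_nonzero positive_orthant rQ).
Proof.
move=> r rQ; split=> [g_gt0 rE|gmod1 gmod2 gi_gt0 _ fsub fsup].
  have [? ?] := minimax_values V1_gt0 V2_gt0 f0 g0 g_ge0 g_gt0 rE.
  by split=> // A B AN BN; exact: saddle_point_indic.
exact: convex_concave_minimax.
Qed.
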